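(* Let $1\le k\le n$ be integers. For any $k$-dimensional linear subspace $W\subset\mathbb R^n$ and any $v\in\mathbb R^n$, let $\varepsilon\sim p_v$. Then, for any $\delta\in(0,1)$, $$\mathbf E\,\Gamma_W(\varepsilon;v)\le k\log\frac{en}{k}\quad\text{and}\quad \mathsf Q_{1-\delta}\big(\Gamma_W(\varepsilon;v)\big)\le k\log\Big(\frac{en}{k}\Big)+\log\Big(\frac1\delta\Big).$$
   Context: $\sigma(t)=1/(1+e^{-t})$. For $v\in\mathbb R^n$ and $\varepsilon\in\{-1,1\}^n$, $p_v(\varepsilon)=\prod_{i=1}^n\sigma(\varepsilon_iv_i)$, a probability mass function on $\{-1,1\}^n$. For a subspace $W\subset\mathbb R^n$, $\Gamma_W(\varepsilon;v)=\sup_{w\in W}\log\frac{p_w(\varepsilon)}{p_v(\varepsilon)}$. For a real random variable $Z$, $\mathsf Q_{1-\delta}(Z)=\inf\{z\in\mathbb R:\mathbf P(Z\le z)\ge1-\delta\}$. *)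

(* Defs.v *)
From HB Require Import structures.
From mathcomp Require Import all_boot all_order all_algebra.
From mathcomp Require Import all_classical all_reals all_analysis.
From mathcomp Require Import ring lra.

Set Implicit Arguments.
Unset Strict Implicit.
Unset Printing Implicit Defensive.

Import Order.TTheory GRing.Theory Num.Theory.
Import numFieldNormedType.Exports.

Local Open Scope classical_set_scope.
Local Open Scope ring_scope.

Definition sigma (R : realType) (t : R) : R := 1 / (1 + expR (- t)).

(* A sign is encoded by a boolean [b], standing for [(-1) ^+ b]:
   [false] is +1 and [true] is -1. *)
Notation signs n := {ffun 'I_n -> bool}.

Definition sign (R : realType) (n : nat) (e : signs n) (i : 'I_n) : R :=
  (-1) ^+ (e i).

Definition prod_pmf (R : realType) (n : nat) (v : 'rV[R]_n) (e : signs n)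
    : R :=
  \prod_(i < n) sigma (sign R e i * v 0 i).

(* The supremum is real-valued; [has_sup_logratio] below shows that it is
   always taken over a nonempty set that is bounded above. *)
Definition Gamma (R : realType) (n : nat) (W : {vspace 'rV[R]_n})
    (v : 'rV[R]_n) (e : signs n) : R :=
  sup [set ln (prod_pmf w e / prod_pmf v e)
          | w in [set w : 'rV[R]_n | w \in W]].

(* [signs n] carries its discrete sigma-algebra: [eps] is a random element of
   [signs n] exactly when the preimages of the points are measurable. *)
Definition has_pmf (d : measure_display) (T : measurableType d) (R : realType)
    (P : probability T R) (n : nat) (eps : T -> signs n) (p : signs n -> R)
    : Prop :=
  forall e : signs n, measurable (eps @^-1` [set e]) /\
                      P (eps @^-1` [set e]) = (p e)%:E.

(* [has_inf_quantile] below shows that the infimum is over a nonempty set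
   bounded below when [Z] is bounded, as any function of a random element of
   the finite type [signs n] is. *)
Definition quantile (d : measure_display) (T : measurableType d) (R : realType)
    (P : probability T R) (q : R) (Z : T -> R) : R :=
  inf [set z : R | (q%:E <= P [set t | (Z t <= z)%R])%E].

Section Wellformedness.
Variable R : realType.
Implicit Types (n : nat).

Lemma sigma_gt0 (t : R) : 0 < sigma t.
Proof. by rewrite divr_gt0 // addr_gt0 // expR_gt0. Qed.

Lemma sigma_le1 (t : R) : sigma t <= 1.
Proof.
by rewrite /sigma ler_pdivrMr ?mul1r ?lerDl ?expR_ge0.
Qed.

Lemma sigmaN (t : R) : sigma t + sigma (- t) = 1.
Proof.
rewrite /sigma opprK expRN; have e0 := expR_gt0 t.
by field; rewrite !gt_eqF //= addr_gt0.
Qed.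

Lemma prod_pmf_gt0 n (v : 'rV[R]_n) (e : signs n) : 0 < prod_pmf v e.
Proof. by apply: prodr_gt0 => i _; exact: sigma_gt0. Qed.

Lemma prod_pmf_le1 n (v : 'rV[R]_n) (e : signs n) : prod_pmf v e <= 1.
Proof.
by apply: prodr_ile1 => i _; rewrite ltW ?sigma_gt0 //= sigma_le1.
Qed.

Lemma prod_pmf_sum n (v : 'rV[R]_n) : \sum_(e : signs n) prod_pmf v e = 1.
Proof.
have := bigA_distr_bigA (fun (i : 'I_n) (b : bool) =>
  sigma ((-1) ^+ b * v 0 i)).
rewrite /prod_pmf /sign => <-; apply: big1 => i _.
by rewrite big_bool /= expr1 expr0 mulN1r mul1r addrC sigmaN.
Qed.

Lemma has_sup_logratio n (W : {vspace 'rV[R]_n}) (v : 'rV[R]_n) (e : signs n) :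
  has_sup [set ln (prod_pmf w e / prod_pmf v e)
          | w in [set w : 'rV[R]_n | w \in W]].
Proof.
split; first by exists (ln (prod_pmf 0 e / prod_pmf v e)), 0 => //=; exact: mem0v.
exists (ln (prod_pmf v e)^-1) => _ [w _ <-].
rewrite ler_ln ?posrE ?divr_gt0 ?invr_gt0 ?prod_pmf_gt0 //.
by rewrite ler_piMl ?prod_pmf_le1 // invr_ge0 ltW ?prod_pmf_gt0.
Qed.

Lemma has_inf_quantile (d : measure_display) (T : measurableType d)
    (P : probability T R) (q M : R) (Z : T -> R) :
  0 < q <= 1 -> (forall x : T, `|Z x| <= M) ->
  has_inf [set z : R | (q%:E <= P [set t | (Z t <= z)%R])%E].
Proof.
move=> /andP[q0 q1] ZM; split.
  exists M => /=; suff -> : [set t | Z t <= M] = setT.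
    by rewrite probability_setT lee_fin.
  by apply/seteqP; split=> t //= _; rewrite (le_trans (ler_norm _)) ?ZM.
exists (- M) => z /= qz; rewrite leNgt; apply/negP => zM.
move: qz; suff -> : [set t | Z t <= z] = set0.
  by rewrite measure0 lee_fin leNgt q0.
apply/seteqP; split=> t //= /le_lt_trans/(_ zM).
by rewrite ltNge lerNl (le_trans _ (ZM t)) // -normrN ler_norm.
Qed.

End Wellformedness.

(* Main.v *)
Require Import Defs.
From HB Require Import structures.
From mathcomp Require Import all_boot all_order all_algebra.
From mathcomp Require Import all_classical all_reals all_analysis.
From mathcomp Require Import ring lra.

(* The coordinate [eps i] is distributed as the sign of [v i - t i] with [t i]
   independent logistic noise, so [sup_w p_w(e)] is at most the probability
   that [e] is the sign pattern of some point of the translate [W - t].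
   Affine translates of a [k]-dimensional space realise at most
   [\sum_(j <= k) 'C(n, j) <= (e n / k) ^ k] sign patterns by Sauer-Shelah:
   they shatter no set of more than [k] coordinates, because such a set carries
   a nonzero linear form vanishing on [W]. Summing over [e] gives
   [E (exp Gamma) <= (e n / k) ^ k], whence the bound on the mean by Jensen and
   the bound on the quantile by Markov. The noise is discretised, only finitely
   many points of [W] being involved up to an arbitrarily small factor. *)

Set Implicit Arguments.
Unset Strict Implicit.
Unset Printing Implicit Defensive.

Import Order.TTheory GRing.Theory Num.Theory.
Import numFieldNormedType.Exports.

Local Open Scope ring_scope.

(** * Shattering and the Sauer-Shelah bound *)

Section Shattering.
Local Open Scope nat_scope.
Variable T : finType.
Implicit Types (F : {set {set T}}) (S A B : {set T}).

Definition shatters F S :=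
  [forall B : {set T}, (B \subset S) ==> [exists A in F, A :&: S == B]].

Lemma shattersP F S :
  reflect (forall B, B \subset S -> exists2 A, A \in F & A :&: S = B)
          (shatters F S).
Proof.
apply: (iffP forallP) => sh B.
  by move=> BS; have /implyP/(_ BS)/exists_inP[A AF /eqP] := sh B; exists A.
apply/implyP => /sh[A AF <-]; apply/exists_inP; by exists A.
Qed.

Lemma shattersW F F' S : F \subset F' -> shatters F S -> shatters F' S.
Proof.
move=> /fintype.subsetP FF' /shattersP sh; apply/shattersP => B /sh[A AF <-].
by exists A => //; exact: FF'.
Qed.

(** Pajor's inequality, by induction on [#|F|]: a point [x] splits [F] into [F1] and [F0], and what
    the halves shatter, counted with multiplicity, injects into what [F] shatters. *)
Lemma shatters_card F : #|F| <= #|[set S | shatters F S]|.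
Proof.
have [m] := ubnP #|F|; elim: m F => // m IHm F; rewrite ltnS => leFm.
have [F1|] := leqP #|F| 1.
  have [->|[A AF]] := set_0Vmem F; first by rewrite cards0.
  rewrite (leq_trans F1)// card_gt0; apply/set0Pn; exists finset.set0.
  rewrite inE; apply/shattersP => B; rewrite finset.subset0 => /eqP ->.
  by exists A => //; rewrite finset.setI0.
case/card_gt1P => A [B [AF BF neqAB]].
(* Splitting at a point that separates two members leaves both halves nonempty, hence both strictly
   smaller than [F]. *)
have {A B neqAB AF BF} [x [A [B [AF BF xA xB]]]] :
    exists x A B, [/\ A \in F, B \in F, x \in A & x \notin B].
  move: neqAB; rewrite finset.eqEsubset negb_and => /orP[] /subsetPn[x xA xB].
    by exists x, A, B.
  by exists x, B, A.
pose X := [set C : {set T} | x \in C]; set F1 := F :&: X; set F0 := F :\: X.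
have cF : #|F1| + #|F0| = #|F| := cardsID X F.
have F1gt0 : 0 < #|F1| by apply/card_gt0P; exists A; rewrite !inE AF.
have F0gt0 : 0 < #|F0| by apply/card_gt0P; exists B; rewrite !inE BF xB.
have IH1 : #|F1| <= #|[set S | shatters F1 S]|.
  by apply: IHm; rewrite (leq_trans _ leFm)// -cF -addn1 leq_add2l.
have IH0 : #|F0| <= #|[set S | shatters F0 S]|.
  by apply: IHm; rewrite (leq_trans _ leFm)// -cF -addn1 addnC leq_add2r.
have notx1 S : shatters F1 S -> x \notin S.
  move=> /shattersP/(_ finset.set0)[|C]; rewrite ?finset.sub0set// !inE => /andP[_ xC].
  by move=> /setP/(_ x); rewrite !inE xC /= => ->.
have notx0 S : shatters F0 S -> x \notin S.
  move=> /shattersP/(_ S)[//|C]; rewrite !inE => /andP[xC _].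
  by move=> /setP/(_ x); rewrite !inE (negbTE xC) /= => <-.
rewrite -cF (leq_trans (leq_add IH1 IH0))// -cardsUI.
set sh1 := [set S | shatters F1 S]; set sh0 := [set S | shatters F0 S].
(* A set [S] shattered by both halves is counted twice; its second copy is charged to [x |: S],
   which [F] also shatters. Since [x] lies in no set shattered by a half, these copies are distinct
   and new. *)
have /card_in_imset <- : {in sh1 :&: sh0 &, injective (fun S => x |: S)}.
  move=> S S'; rewrite !inE => /andP[/notx1 xS _] /andP[/notx1 xS' _].
  by move=> /(congr1 (fun S => S :\ x)); rewrite !finset.setU1K.
rewrite -cardsUI [X in _ + X](_ : _ = 0) ?addn0.
  apply/subset_leq_card/fintype.subsetP => S; rewrite !inE => /orP[/orP[]|].
  - exact/shattersW/finset.subsetIl.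
  - exact/shattersW/finset.subsetDl.
  case/imsetP => S'; rewrite !inE => /andP[sh1S' sh0S'] ->.
  have xS' := notx1 _ sh1S'.
  apply/shattersP => C CS.
  have CS' : C :\ x \subset S' by rewrite subDset.
  have [xC|xC] := boolP (x \in C).
    have /shattersP/(_ _ CS')[D] := sh1S'; rewrite !inE => /andP[DF xD] DC.
    exists D => //; rewrite finset.setIUr DC (finset.setIidPr _) ?finset.sub1set//.
    by rewrite finset.setD1K.
  have /shattersP/(_ _ CS')[D] := sh0S'; rewrite !inE => /andP[xD DF] DC.
  exists D => //; rewrite finset.setIUr DC (_ : _ :&: _ = finset.set0).
    rewrite finset.set0U; apply/setP => y; rewrite !inE.
    by case: eqP => //= ->; rewrite (negbTE xC).
  by apply/setP => y; rewrite !inE; case: eqP => [->|]; rewrite ?(negbTE xD) ?andbF.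
apply/eqP; rewrite cards_eq0 -finset.subset0; apply/fintype.subsetP => S; rewrite !inE.
case/andP => /orP shS /imsetP[S' _ eS]; have : x \in S by rewrite eS setU11.
by apply: contraTT => _; case: shS => [/notx1|/notx0].
Qed.

Lemma sauer_shelah F k :
    (forall S, shatters F S -> #|S| <= k) ->
  #|F| <= \sum_(j < k.+1) 'C(#|T|, j).
Proof.
move=> shk; rewrite (leq_trans (shatters_card F))//.
under eq_bigr => j _ do rewrite -[X in 'C(X, _)]cardsT -cards_draws.
rewrite -sum1_card.
rewrite (partition_big (fun S => inord #|S| : 'I_k.+1) predT)//=.
apply: leq_sum => j _; rewrite sum1_card.
apply/subset_leq_card/fintype.subsetP => S; rewrite inE => /andP[]; rewrite inE => /shk Sk /eqP <-.
by rewrite inordK ?ltnS// finset.subsetT /=.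
Qed.

End Shattering.

(** * Estimate of the partial binomial sum *)

Section Binomial.
Variable R : realType.

Lemma sum_binomial_le (n k : nat) : (1 <= k <= n)%N ->
  (\sum_(j < k.+1) 'C(n, j))%:R <= expR (k%:R * ln (expR 1 * n%:R / k%:R)) :> R.
Proof.
move=> /andP[k1 kn].
have k0 : 0 < k%:R :> R by rewrite ltr0n.
have n0 : 0 < n%:R :> R by rewrite ltr0n (leq_trans k1).
have nk1 : 1 <= n%:R / k%:R :> R by rewrite ler_pdivlMr// mul1r ler_nat.
have q0 : 0 < expR 1 * n%:R / k%:R :> R by rewrite !mulr_gt0 ?invr_gt0 ?expR_gt0.
rewrite expRM_natl lnK// -mulrA exprMn.
have -> : expR 1 ^+ k = expR (k%:R / n%:R) ^+ n :> R.
  by rewrite -!expRM_natl mulr1 mulrC divfK ?gt_eqF.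
(* Since [n / k >= 1], multiplying the term of index [j <= k] by [(n / k) ^ (k - j)] only increases
   it; adding the terms with [j > k] completes the expansion of [(1 + k / n) ^ n], which is at most
   [e ^ k]. *)
apply: (@le_trans _ _ ((k%:R / n%:R + 1) ^+ n * (n%:R / k%:R) ^+ k)); last first.
  rewrite ler_pM2r ?exprn_gt0 ?divr_gt0//.
  apply: lerXn2r; rewrite ?nnegrE ?expR_ge0 ?addr_ge0 ?divr_ge0//.
  by rewrite addrC expR_ge1Dx.
rewrite natr_sum addrC exprDn mulr_suml.
rewrite -(big_mkord xpredT (fun j => 'C(n, j)%:R)) /=.
rewrite -(big_mkord xpredT (fun j => (1 ^+ (n - j) * (k%:R / n%:R) ^+ j *+ 'C(n, j)) *
   (n%:R / k%:R) ^+ k)) /=.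
rewrite [leRHS](big_cat_nat (n := k.+1))//= -[leLHS]addr0 lerD//; last first.
  apply: sumr_ge0 => j _; rewrite expr1n mul1r.
  by rewrite mulr_ge0 ?mulrn_wge0 ?exprn_ge0 ?divr_ge0 ?ltW.
apply: ler_sum_nat => j; rewrite ltnS => /andP[_ jk].
rewrite expr1n mul1r -[_ ^+ j *+ _]mulr_natl -mulrA ler_peMr//.
rewrite -[X in _ <= _ * _ ^+ X](subnKC jk) exprD mulrA -exprMn.
have -> : k%:R / n%:R * (n%:R / k%:R) = 1 :> R by field; rewrite !gt_eqF.
by rewrite expr1n mul1r exprn_ege1.
Qed.

End Binomial.

(** * Sign patterns of translates of a subspace *)

Section SignPatterns.
Variables (R : realType) (n : nat) (W : {vspace 'rV[R]_n}).

(** The coordinates in [S] of a basis of [W] form a matrix with more rows than columns, so its left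
    kernel is nonzero. *)
Lemma annihilator_coord (S : {set 'I_n}) : (\dim W < #|S|)%N ->
  exists2 u : 'I_#|S| -> R, exists a, u a != 0 &
    forall w, w \in W -> \sum_a u a * w 0 (enum_val a) = 0.
Proof.
move=> WS.
pose M : 'M[R]_(#|S|, \dim W) :=
  \matrix_(a, j) (vbasis W)`_j 0 (enum_val a).
have : kermx M != 0.
  rewrite -mxrank_eq0 mxrank_ker -lt0n subn_gt0.
  exact: leq_ltn_trans (rank_leq_col M) WS.
case/rowV0Pn => u /sub_kermxP uM /rV0Pn[a ua].
exists (u 0); first by exists a.
move=> w /coord_vbasis ->.
under eq_bigr => b _ do rewrite summxE mulr_sumr.
rewrite exchange_big big1//= => j _.
transitivity (coord (vbasis W) j w * (u *m M) 0 j); last by rewrite uM mxE mulr0.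
by rewrite mxE mulr_sumr; apply: eq_bigr => b _; rewrite !mxE mulrCA.
Qed.

Variable th : 'I_n -> R.

(* A family of sign patterns of [W - th], a pattern being recorded by the set
   of its negative coordinates. *)
Lemma shatters_sign_patterns (F : {set {set 'I_n}}) (S : {set 'I_n}) :
  (forall A, A \in F ->
     exists2 w, w \in W & forall i, (i \in A) = (w 0 i < th i)) ->
  shatters F S -> (#|S| <= \dim W)%N.
Proof.
move=> FW /shattersP shS; rewrite leqNgt; apply/negP.
move=> /annihilator_coord[u [a ua] uW].
(* Shattering yields [w] in [W] lying below [th] on [S] exactly where [s] is positive. Every term of
   the sum of [s * (th - w)] is then nonnegative, and [w] drops out because [s] annihilates [W]. *)
have key (s : 'I_#|S| -> R) : (forall w, w \in W ->
    \sum_a s a * w 0 (enum_val a) = 0) ->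
    0 <= \sum_a s a * th (enum_val a) /\
    forall b, 0 < s b -> 0 < \sum_a s a * th (enum_val a).
  move=> sW.
  pose B := [set enum_val a | a in [pred a | 0 < s a]].
  have [|A /FW[w wW Aw] AB] := shS B.
    by apply/fintype.subsetP => _ /imsetP[b _ ->]; exact: enum_valP.
  have sB b : (w 0 (enum_val b) < th (enum_val b)) = (0 < s b).
    have <- : (enum_val b \in B) = (0 < s b).
      by rewrite mem_imset ?inE//; exact: enum_val_inj.
    by rewrite -AB inE enum_valP andbT Aw.
  have -> : \sum_a s a * th (enum_val a) =
      \sum_a s a * (th (enum_val a) - w 0 (enum_val a)).
    by under [RHS]eq_bigr do rewrite mulrBr; rewrite sumrB sW ?subr0.
  have ge0 b : 0 <= s b * (th (enum_val b) - w 0 (enum_val b)).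
    have := sB b; case: (ltP 0 (s b)) => sb wb.
      by rewrite mulr_ge0 ?subr_ge0 ?ltW ?wb.
    by rewrite mulr_le0// subr_le0 leNgt wb.
  split=> [|b sb]; first exact: sumr_ge0.
  rewrite (bigD1 b)//= ltr_pwDl ?sumr_ge0// mulr_gt0// subr_gt0 sB.
  exact: sb.
(* Applied to [u] and to [- u], [key] makes the sum of [u * th] vanish, while the nonzero entry
   [u a] makes one of the two inequalities strict. *)
have [c_ge0 c_gt0] := key _ uW.
have [|cN_ge0 cN_gt0] := key (fun a => - u a).
  by move=> w /uW uw; under eq_bigr do rewrite mulNr; rewrite sumrN uw oppr0.
have cN : \sum_a - u a * th (enum_val a) = - \sum_a u a * th (enum_val a).
  by rewrite -sumrN; apply: eq_bigr => b _; rewrite mulNr.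
case: (ltgtP (u a) 0) ua => // ua _.
  by have := cN_gt0 a; rewrite oppr_gt0 => /(_ ua); rewrite cN oppr_gt0 ltNge c_ge0.
by move: (c_gt0 a ua) cN_ge0; rewrite cN oppr_ge0 leNgt => ->.
Qed.

Lemma card_sign_patterns (w : signs n -> 'rV[R]_n) :
  (forall e, w e \in W) ->
  (#|[set e : signs n | [forall i, e i == (w e 0 i < th i)%R]]| <=
   \sum_(j < (\dim W).+1) 'C(n, j))%N.
Proof.
move=> wW; set E := [set e | _].
have inj : injective (fun e : signs n => [set i | e i]).
  by move=> e e' /setP ee'; apply/ffunP => i; have := ee' i; rewrite !inE.
rewrite -(card_imset E inj); under eq_bigr do rewrite -[X in 'C(X, _)]card_ord.
apply: sauer_shelah => S; apply: shatters_sign_patterns => A /imsetP[e].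
rewrite inE => /forallP eE ->.
by exists (w e) => // i; rewrite inE; apply/eqP.
Qed.

End SignPatterns.

(** * Discretised logistic noise and the sum of maximised likelihoods *)

Section ShtarkovSum.
Variable R : realType.

Lemma sigma_nondecreasing : {homo @sigma R : x y / x <= y}.
Proof.
move=> x y xy; rewrite /sigma !div1r lef_pV2 ?posrE ?addr_gt0 ?expR_gt0//.
by rewrite lerD2l ler_expR lerN2.
Qed.

(** The increments of [f] between consecutive distinct points serve as weights, each placed at the
    right endpoint. *)
Lemma threshold_mixture_sorted (f : R -> R) (c : R) (s : seq R) :
  {homo f : x y / x <= y} -> (forall x, f x <= 1) -> path <=%R c s ->
  exists L : seq (R * R), [/\ all (fun p => (0 <= p.1) && (c < p.2)) L,
    \sum_(p <- L) p.1 = 1 - f c &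
    {in c :: s, forall y, f y - f c = \sum_(p <- L) p.1 * (p.2 <= y)%R%:R}].
Proof.
move=> f_mono f_le1; elim: s c => [|y s IHs] c /=.
  (* The remaining mass sits at [c + 1], beyond the last point, where no listed point reaches it. *)
  move=> _; exists [:: (1 - f c, c + 1)]; split.
  - by rewrite /= subr_ge0 f_le1 ltrDl ltr01.
  - by rewrite big_seq1.
  - by move=> y; rewrite inE => /eqP ->; rewrite big_seq1 subrr/= gerDl ler10 mulr0.
case/andP => cy ys; have [L [L_ok L_sum L_eq]] := IHs y ys.
case: (ltgtP c y) cy => // [cy _|-> _]; last first.
  by exists L; split => // z; rewrite inE => /predU1P[->|]; apply: L_eq; rewrite inE eqxx.
exists ((f y - f c, y) :: L); split.
- rewrite /= subr_ge0 f_mono ?ltW// cy/=.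
  by apply: sub_all L_ok => p /andP[-> /(lt_trans cy)].
- by rewrite big_cons L_sum/=; ring.
move=> z; rewrite inE big_cons => /predU1P[->|zs] /=.
  rewrite subrr lt_geF// mulr0 add0r big_seq big1// => p pL.
  have /andP[_ yp] := allP L_ok _ pL.
  by rewrite lt_geF ?mulr0// (lt_trans cy).
rewrite -L_eq//; suff -> : y <= z by rewrite mulr1; ring.
move: zs; rewrite inE => /predU1P[->//|].
exact/allP/(order_path_min le_trans ys).
Qed.

(** On finitely many points, [f] agrees with the distribution function of a finitely supported
    law. *)
Lemma threshold_mixture (A : finType) (x : A -> R) (f : R -> R) :
  {homo f : x y / x <= y} -> (forall x, 0 <= f x <= 1) ->
  exists (m : nat) (mu th : 'I_m -> R), [/\ forall j, 0 <= mu j,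
    \sum_j mu j = 1 & forall a, f (x a) = \sum_j mu j * (th j <= x a)%R%:R].
Proof.
move=> f_mono f01; pose s := sort <=%R [seq x a | a <- enum A].
have xs a : x a \in s by rewrite mem_sort map_f ?mem_enum.
have s_sorted : sorted <=%R s by exact: sort_le_sorted.
(* A threshold below all the points carries the base mass [f c], which therefore counts at every
   point. *)
pose c := head 0 s - 1.
have cs : path <=%R c s.
  by case: (s) @c s_sorted => //= y s' ->; rewrite gerBl ler01.
have f_le1 y : f y <= 1 by have /andP[] := f01 y.
have [L [/allP L_ok L_sum L_eq]] := threshold_mixture_sorted f_mono f_le1 cs.
pose L' := (f c, c) :: L.
exists (size L'), (fun j => (tnth (in_tuple L') j).1),
  (fun j => (tnth (in_tuple L') j).2); split.
- move=> j; have := mem_tnth j (in_tuple L'); rewrite inE => /predU1P[->|].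
    by have /andP[] := f01 c.
  by move=> /L_ok/andP[].
- rewrite -(big_tnth _ _ L' xpredT (fun p => p.1)) big_cons L_sum/=; ring.
move=> a.
rewrite -(big_tnth _ _ L' xpredT (fun p => p.1 * (p.2 <= x a)%R%:R)) big_cons/=.
rewrite -L_eq; last by rewrite inE xs orbT.
suff -> : c <= x a by rewrite mulr1; ring.
exact: (allP (order_path_min le_trans cs)).
Qed.

Variables (n : nat) (W : {vspace 'rV[R]_n}).

(* A threshold [t] drawn with weights [mu] makes [sign e i] the sign of
   [w 0 i - t] with probability [sigma (sign R e i * w 0 i)], so the left-hand
   side is the expected number of [e] realised as the sign pattern of
   [w e - t], with independent thresholds across the coordinates. *)
Lemma shtarkov_sum_le (w : signs n -> 'rV[R]_n) : (forall e, w e \in W) ->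
  \sum_e prod_pmf (w e) e <= (\sum_(j < (\dim W).+1) 'C(n, j))%:R.
Proof.
move=> wW.
have s01 x : 0 <= @sigma R x <= 1 by rewrite ltW ?sigma_gt0//= sigma_le1.
(* The points are the coordinates of all the [w e] at once, so that one law of thresholds serves
   every [e] and every coordinate. *)
have [m [mu [th [mu_ge0 mu1 sE]]]] := threshold_mixture
  (fun p : signs n * 'I_n => w p.1 0 p.2) sigma_nondecreasing s01.
have termE e i : sigma (sign R e i * w e 0 i) =
    \sum_j mu j * (e i == (w e 0 i < th j))%:R.
  have {}sE := sE (e, i); rewrite /= in sE.
  rewrite /sign; case: (e i); last first.
    rewrite mul1r sE; apply: eq_bigr => j _.
    by rewrite eq_sym eqbF_neg -leNgt.
  rewrite expr1 mulN1r; have /(canRL (addKr _)) -> := sigmaN (w e 0 i).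
  rewrite sE addrC -[X in X - _]mu1 -sumrB; apply: eq_bigr => j _; rewrite eq_sym eqb_id ltNge.
  by case: (_ <= _)%R; rewrite ?mulr1 ?mulr0 ?subr0 ?subrr.
rewrite /prod_pmf; under eq_bigr => e _.
  under eq_bigr => i _ do rewrite termE.
  rewrite (bigA_distr_bigA (fun i j => mu j * (e i == (w e 0 i < th j))%:R)).
  over.
rewrite exchange_big/=.
(* The product weights of the threshold vectors sum to 1, so the pattern count can be bounded for
   each vector [t] separately. *)
have -> : (\sum_(j < (\dim W).+1) 'C(n, j))%:R =
    \sum_(t : {ffun 'I_n -> 'I_m}) (\prod_i mu (t i)) *
      (\sum_(j < (\dim W).+1) 'C(n, j))%:R :> R.
  by rewrite -mulr_suml -(bigA_distr_bigA (fun _ => mu))/= mu1 big1_eq mul1r.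
apply: ler_sum => t _.
under eq_bigr do rewrite big_split/=.
rewrite -mulr_sumr ler_wpM2l ?prodr_ge0//.
pose E := [set e : signs n | [forall i, e i == (w e 0 i < th (t i))]].
apply: (@le_trans _ _ #|E|%:R); last first.
  by rewrite ler_nat card_sign_patterns.
rewrite -sum1_card natr_sum [leRHS]big_mkcond/=; apply: ler_sum => e _.
rewrite inE; case: forallP => [_|/forallP]; last first.
  by rewrite negb_forall => /existsP[i /negbTE ei]; rewrite (bigD1 i)//= ei mul0r.
by apply: prodr_ile1 => i _; rewrite ler0n lern1 leq_b1.
Qed.

End ShtarkovSum.

(** * From near-maximisers in [W] to the exponential moment *)

Section ExponentialMoment.
Variables (R : realType) (n : nat) (W : {vspace 'rV[R]_n}) (v : 'rV[R]_n).

(** The summand is the supremum over [W] of [prod_pmf w e], which need not be attained. Choosing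
    [w e] within a factor [1 + r / expR L] of it costs exactly an additive [r] in the bound. *)
Lemma sum_expR_Gamma_le (L : R) :
  (forall w : signs n -> 'rV[R]_n, (forall e, w e \in W) ->
     \sum_e prod_pmf (w e) e <= expR L) ->
  \sum_e prod_pmf v e * expR (Gamma W v e) <= expR L.
Proof.
move=> sumL; apply/ler_addgt0Pr => r r0.
have L0 := expR_gt0 L.
have q1 : 1 < 1 + r / expR L by rewrite ltrDl divr_gt0.
have /choice[w wP] e : exists w, w \in W /\
    prod_pmf v e * expR (Gamma W v e) <= (1 + r / expR L) * prod_pmf w e.
  have [_ [w wW <-]] := sup_adherent (ln_gt0 q1) (has_sup_logratio W v e).
  rewrite -/(Gamma W v e) ltrBlDr -ltr_expR expRD !lnK ?posrE => [lt_w||].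
  - exists w; split=> //; rewrite -ler_pdivlMl ?prod_pmf_gt0//.
    by rewrite (le_trans (ltW lt_w))// le_eqVlt; apply/orP; left; apply/eqP; ring.
  - by rewrite (lt_trans _ q1).
  - by rewrite divr_gt0 ?prod_pmf_gt0.
apply: (@le_trans _ _ (\sum_e (1 + r / expR L) * prod_pmf (w e) e)).
  by apply: ler_sum => e _; have [] := wP e.
rewrite -mulr_sumr (_ : expR L + r = (1 + r / expR L) * expR L).
  rewrite ler_wpM2l ?sumL ?ltW ?(lt_trans _ q1)// => e.
  by have [] := wP e.
by rewrite mulrDl mul1r divfK ?gt_eqF.
Qed.

End ExponentialMoment.

(** * Mean and tail from an exponential moment *)

Section WeightedTail.
Variables (R : realType) (I : finType) (p g : I -> R) (L : R).
Hypotheses (p_ge0 : forall i, 0 <= p i) (p_sum : \sum_i p i = 1).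
Hypothesis exp_moment : \sum_i p i * expR (g i) <= expR L.

Lemma exp_moment_shift (z : R) :
  \sum_i p i * expR (g i - z) <= expR (L - z).
Proof.
under eq_bigr do rewrite expRD mulrA.
by rewrite -mulr_suml expRD ler_wpM2r ?expR_ge0.
Qed.

(** Jensen's inequality, through the tangent line [1 + x <= expR x] at [x = g i - L]. *)
Lemma mean_le_log_exp_moment : \sum_i p i * g i <= L.
Proof.
apply: (@le_trans _ _ (\sum_i (p i * (L - 1) + p i * expR (g i - L)))).
  apply: ler_sum => i _; rewrite -mulrDr ler_wpM2l//.
  by have := expR_ge1Dx (g i - L); lra.
rewrite big_split/= -mulr_suml p_sum.
by have := exp_moment_shift L; rewrite subrr expR0; lra.
Qed.

(** Markov's inequality in pointwise form: [1 - expR (g i - z)] is at most the indicator of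
    [g i <= z]. *)
Lemma exp_tail_bound (z : R) :
  1 - expR (L - z) <= \sum_i p i * (g i <= z)%R%:R.
Proof.
apply: (@le_trans _ _ (\sum_i (p i - p i * expR (g i - z)))).
  by rewrite sumrB p_sum lerD2l lerN2 exp_moment_shift.
apply: ler_sum => i _; rewrite -[X in X - _]mulr1 -mulrBr ler_wpM2l//.
have := expR_gt0 (g i - z); have := expR_ge1Dx (g i - z).
by case: (leP (g i) z) => ? /=; rewrite ?mulr0n ?mulr1n; lra.
Qed.

End WeightedTail.

Local Open Scope classical_set_scope.

(** * Transfer to a random sign vector *)

Section FiniteLaw.
Context d (T : measurableType d) (R : realType) (P : probability T R) (n : nat).
Variables (eps : T -> signs n) (p : signs n -> R).
Hypothesis epsP : has_pmf P eps p.

Lemma expectation_has_pmf (g : signs n -> R) :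
  ('E_P[fun t => g (eps t)] = (\sum_e p e * g e)%:E)%E.
Proof.
rewrite unlock.
under eq_integral => t _.
  rewrite (_ : _%:E = \sum_e (g e)%:E * (\1_(eps @^-1` [set e]) t)%:E)%E; last first.
    rewrite (bigD1 (eps t))//= big1 => [|e ne].
      by rewrite indicE mem_set//= mule1 adde0.
    by rewrite indicE memNset ?mule0//= => /esym/eqP; rewrite (negbTE ne).
  over.
have intI e : P.-integrable setT (fun t => (\1_(eps @^-1` [set e]) t)%:E).
  by apply: integrable_indic; have [] := epsP e.
rewrite integral_sum//; last by move=> e; exact: integrableZl.
rewrite -sumEFin; apply: eq_bigr => e _.
have [me Pe] := epsP e.
by rewrite integralZl// integral_indic// setIT muleC EFinM -Pe.
Qed.

Lemma probability_has_pmf (A : pred (signs n)) :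
  P [set t | A (eps t)] = (\sum_e p e * (A e)%:R)%:E.
Proof.
have mA : measurable [set t | A (eps t)].
  rewrite (_ : [set t | _] = \bigcup_(e in [set e | A e]) eps @^-1` [set e]).
    by apply: fin_bigcup_measurable => [|e _]; [exact: finite_finset|have [] := epsP e].
  by apply/seteqP; split => [t At|t [e /= Ae ->]] //; exists (eps t).
rewrite -(expectation_indic P mA) -(expectation_has_pmf (fun e => (A e)%:R)).
congr expectation; apply/funext => t; rewrite indicE; congr (_%:R).
by case: (boolP (A (eps t))) => At; [rewrite mem_set|rewrite memNset//; exact/negP].
Qed.

Lemma quantile_le (q z : R) (g : signs n -> R) : 0 < q <= 1 ->
  q <= \sum_e p e * (g e <= z)%R%:R -> quantile P q (fun t => g (eps t)) <= z.
Proof.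
move=> q01 qz; apply: ge_inf; last first.
  by rewrite /= (probability_has_pmf (fun e => g e <= z)) lee_fin.
(* Boundedness of [g] makes the set defining the quantile bounded below, so its infimum is at most
   its member [z]. *)
have gM t : `|g (eps t)| <= \sum_e `|g e|.
  by rewrite (bigD1 (eps t))//= lerDl sumr_ge0.
by have [] := has_inf_quantile P q01 gM.
Qed.

End FiniteLaw.

Theorem proposition2p1 (R : realType) (k n : nat)
    (hk : (1 <= k)%N) (hkn : (k <= n)%N)
    (W : {vspace 'rV[R]_n}) (hW : \dim W = k) (v : 'rV[R]_n)
    (d : measure_display) (T : measurableType d) (P : probability T R)
    (eps : T -> signs n) (heps : has_pmf P eps (prod_pmf v))
    (delta : R) (hdelta : 0 < delta < 1) :
  ('E_P[fun t => Gamma W v (eps t)]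
     <= (k%:R * ln (expR 1 * n%:R / k%:R))%:E)%E
  /\ quantile P (1 - delta) (fun t => Gamma W v (eps t))
     <= k%:R * ln (expR 1 * n%:R / k%:R) + ln (1 / delta).
Proof.
set L := k%:R * _.
have p_ge0 e : 0 <= prod_pmf v e by rewrite ltW// prod_pmf_gt0.
have moment : \sum_e prod_pmf v e * expR (Gamma W v e) <= expR L.
  apply: sum_expR_Gamma_le => w /shtarkov_sum_le/le_trans; apply.
  by rewrite hW sum_binomial_le ?hk.
split.
  by rewrite (expectation_has_pmf heps) lee_fin mean_le_log_exp_moment ?prod_pmf_sum.
have /andP[d0 d1] := hdelta.
apply: (quantile_le heps); first lra.
(* The level [z = L + ln (1 / delta)] is the one at which [expR (L - z)] equals [delta]. *)
rewrite (_ : 1 - delta = 1 - expR (L - (L + ln (1 / delta)))).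
  exact: exp_tail_bound p_ge0 (prod_pmf_sum v) moment _.
by rewrite opprD addNKr div1r lnV ?posrE// opprK lnK.
Qed.
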